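(* Let $T$ be a power-bounded linear operator on a (real or complex) Banach space $X$. Then the following are equivalent: (i) $T$ is uniformly ergodic. (ii) $D(H)$ is closed. (iii) $D(H)=\overline{(I-T)X}$. (iv) $D(H)=(I-T)X$. (v) For every $y \in \overline{(I-T)X}$ there is $0<\beta<1$ such that $\|M_n(T)y\| =O(1/n^\beta)$.
   Context: For a bounded linear operator $T$ on a Banach space $X$: $T$ is power-bounded if $\sup_n\|T^n\|<\infty$; $M_n(T):=\frac1n\sum_{k=1}^n T^k$; $T$ is uniformly ergodic if $M_n(T)$ converges in operator norm. $D(H)$ denotes the set of $x\in X$ for which the limit $H_Tx:=\lim_{n\to\infty}\sum_{k=1}^n \frac1k T^kx$ exists in norm. *)

(* Defs.v *)
From HB Require Import structures.
From mathcomp Require Import all_boot all_order all_algebra.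
From mathcomp Require Import all_classical all_reals all_analysis.
From mathcomp Require Import complex.

Set Implicit Arguments.
Unset Strict Implicit.
Unset Printing Implicit Defensive.

Import Order.TTheory GRing.Theory Num.Theory.
Import numFieldNormedType.Exports.

Local Open Scope classical_set_scope.
Local Open Scope ring_scope.

Inductive scalars := RealScalars | ComplexScalars.

Definition scalar_field (R : realType) (s : scalars) : numFieldType :=
  match s with
  | RealScalars => R
  | ComplexScalars => R[i]%C
  end.

Definition real_part (R : realType) (s : scalars) : scalar_field R s -> R :=
  match s with
  | RealScalars => fun z => z
  | ComplexScalars => fun z => complex.Re z
  end.

Section Operators.
Variables (R : realType) (s : scalars).
Variable X : completeNormedModType (scalar_field R s).
Implicit Types (S T : X -> X) (x : X).

(* In the library the norm of a vector lies in the scalar field; over the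
   complex numbers it is a complex number with zero imaginary part. *)
Definition rnorm x : R := real_part `|x|.

(* The value is +oo when S is unbounded on the unit ball. *)
Definition opnorm S : \bar R :=
  ereal_sup [set (rnorm (S x))%:E | x in [set x | rnorm x <= 1]].

Definition bounded_operator S : Prop := (opnorm S < +oo)%E.

Definition power_bounded T : Prop :=
  (ereal_sup [set opnorm (iter n T) | n in [set: nat]] < +oo)%E.

(* For n = 0 this is the zero map. *)
Definition ergodic_mean T (n : nat) : X -> X :=
  fun x => n%:R^-1 *: \sum_(1 <= k < n.+1) iter k T x.

Definition uniformly_ergodic T : Prop :=
  exists E : {linear X -> X}, bounded_operator E /\
    opnorm (fun x => ergodic_mean T n x - E x) @[n --> \oo] --> 0%E.

Definition hilbert_domain T : set X :=
  [set x | cvgn (fun n => \sum_(1 <= k < n.+1) k%:R^-1 *: iter k T x)].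

Definition range_I_minus T : set X := range (fun x => x - T x).

End Operators.

(* Main.v *)
Require Import Defs.
From HB Require Import structures.
From mathcomp Require Import all_boot all_order all_algebra.
From mathcomp Require Import all_classical all_reals all_analysis.
From mathcomp Require Import complex ring lra.

Set Implicit Arguments.
Unset Strict Implicit.
Unset Printing Implicit Defensive.

Import Order.TTheory GRing.Theory Num.Theory.
Import numFieldNormedType.Exports.

Local Open Scope classical_set_scope.
Local Open Scope ring_scope.

(** Write N for the norm, M_n for the ergodic means, h_n for the harmonic sums
    and Y for the closure of (I - T)X.  Power-boundedness gives
    N(M_n (I - T) x) <= (2C / n) N(x), so Y is exactly the set of vectors on
    which M_n tends to 0 ([closure_range_cvg]).

    All five conditions revolve around one property, [mean_contraction]: some
    M_n with n > 0 has norm at most 1/2 on Y.  If it holds, I - M_n is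
    invertible on Y by a Neumann series; as I - M_n factors through I - T, this
    gives Y = (I - T)X ([contraction_closed_range]).  Solving (I - T) v = w
    twice writes x as a fixed vector plus (I - T) v with N(v) controlled by
    N(x), whence M_n x converges at rate 1 / n uniformly on the unit ball
    ([contraction_uniformly_ergodic]).  Conversely, the limit of a uniformly
    ergodic T vanishes on Y, so that the contraction property holds.

    The one-sided Hilbert domain D(H) always lies between (I - T)X and Y.  The
    upper inclusion rests on h_n N(M_n x) <= C N(H_n x) + 2 C^2 N(x)
    ([harmonic_mean_le]), where H_n is the n-th partial sum of the Hilbert
    series: M_n hardly changes under T^k for k small compared with n, so
    M_n H_n is h_n M_n up to a bounded error.  The same estimate shows that if
    D(H) = Y, then h_n M_n y is bounded for every y in Y; a polynomial rate
    gives this too, since h_n = O(n^beta) for every beta > 0.  A gliding hump turns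
    this pointwise information into the contraction property
    ([divergent_rate_contraction]).

    The step from D(H) = (I - T)X to a polynomial rate uses a square root A of
    I - T, given by the absolutely convergent binomial series of
    (1 - z)^(1/2) ([sqrt_I_minus_exists]).  One has N(M_n A x) = O(n^(-1/2)),
    and by an Abel summation this rate puts the range of A inside D(H).  Hence
    for y in Y the vector A y belongs to D(H) = (I - T)X, so that A y = A (A w)
    for some w.  Then y - A w is fixed by T and lies in Y, where the only fixed
    vector is 0.  So y = A w, and y inherits the rate n^(-1/2)
    ([hilbert_domain_range_rate]). *)

(** * The binomial coefficients of the square root *)

Section SqrtCoefficients.
Variable R : realType.

(** The Taylor coefficients of (1 - z)^(-1/2), that is, the central binomial
    coefficient of 2n over n divided by 4^n. *)
Fixpoint isqrt_coef (n : nat) : R :=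
  if n is m.+1 then isqrt_coef m * (2 * m%:R + 1) / (2 * m%:R + 2) else 1.
Local Notation p := isqrt_coef.

Let d0 n : (2 * n%:R + 2 : R) != 0.
Proof. by rewrite gt_eqF // ltr_wpDl // mulr_ge0. Qed.

Lemma isqrt_coefS n : (2 * n%:R + 2) * p n.+1 = (2 * n%:R + 1) * p n.
Proof. by rewrite /=; field; exact: d0. Qed.

Lemma isqrt_coef_gt0 n : 0 < p n.
Proof.
elim: n => //= n IH; rewrite divr_gt0 ?mulr_gt0 // ltr_wpDl // mulr_ge0 //.
Qed.

Lemma isqrt_coefB n : p n - p n.+1 = p n / (2 * n%:R + 2).
Proof. by rewrite /=; field; exact: d0. Qed.

Lemma isqrt_coef_le n : p n.+1 <= p n.
Proof.
by rewrite -subr_ge0 isqrt_coefB divr_ge0 ?(ltW (isqrt_coef_gt0 _)).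
Qed.

(** The sums on the left are the coefficients of (1 - z)^(-3/2). *)
Lemma isqrt_coef_sum n : \sum_(0 <= j < n) p j = 2 * n%:R * p n.
Proof.
elim: n => [|n IH]; first by rewrite big_geq // mulr0 mul0r.
rewrite big_nat_recr //= IH -(natr1 n); field; exact: d0.
Qed.

(** The left-hand side is nonincreasing in n: consecutive values have ratio
    (2n + 3)(2n + 1) / (2n + 2)^2 < 1. *)
Lemma isqrt_coef_sqr n : (2 * n%:R + 1) * p n ^+ 2 <= 1.
Proof.
elim: n => [|n IH]; first by rewrite mulr0 add0r expr1n mulr1.
apply: le_trans IH; rewrite -(natr1 n) /=.
have -> : (2 * (n%:R + 1) + 1) * (p n * (2 * n%:R + 1) / (2 * n%:R + 2)) ^+ 2 =
  ((2 * n%:R + 1) * p n ^+ 2) *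
    ((2 * n%:R + 3) * (2 * n%:R + 1) / (2 * n%:R + 2) ^+ 2).
  by field; exact: d0.
have n0 : (0 : R) <= n%:R by [].
rewrite ler_piMr //; first by rewrite mulr_ge0 ?sqr_ge0 // addr_ge0 // mulr_ge0.
rewrite ler_pdivrMr ?mul1r; last by rewrite exprn_gt0 // ltr_wpDl // mulr_ge0.
by nra.
Qed.

Arguments isqrt_coef : simpl never.

(** Squaring (1 - z)^(-1/2) gives 1 / (1 - z).  Weighting the n-th convolution
    S_n by the index i multiplies it by n / 2, by symmetry; the recurrence of
    the coefficients then gives (n + 1) S_(n+1) = n S_n + S_n. *)
Lemma isqrt_coef_conv n : \sum_(i < n.+1) p i * p (n - i) = 1.
Proof.
pose S m := \sum_(i < m.+1) p i * p (m - i).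
have weighted m : \sum_(i < m.+1) 2 * i%:R * (p i * p (m - i)) = m%:R * S m.
  have W : \sum_(i < m.+1) i%:R * (p i * p (m - i)) =
           \sum_(i < m.+1) (m - i)%:R * (p i * p (m - i)).
    rewrite (reindex_inj rev_ord_inj); apply: eq_bigr => i _ /=.
    by rewrite subSS subKn -1?ltnS // [p (m - i) * _]mulrC.
  under eq_bigr do rewrite -mulrA mulr2n mulrDl mul1r.
  rewrite big_split /= {2}W -big_split /= mulr_sumr; apply: eq_bigr => i _.
  by rewrite -mulrDl -natrD subnKC // -ltnS.
elim: n => [|n IH]; first by rewrite big_ord1 mulr1.
have n0 : n.+1%:R != 0 :> R by rewrite pnatr_eq0.
apply: (mulfI n0); rewrite mulr1 -/(S n.+1) -weighted big_ord_recl mulr0 mul0r add0r.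
rewrite -(natr1 n) -[in RHS](mulr1 n%:R) -[X in _ * X + _]IH -[X in _ + X]IH.
rewrite -weighted -big_split /=; apply: eq_bigr => i _.
rewrite /bump /= add1n subSS -(natr1 i) mulrDr mulr1 mulrA isqrt_coefS; ring.
Qed.

Lemma cvg_isqrt_coef : p n @[n --> \oo] --> (0 : R).
Proof.
apply/cvgr0Pnorm_lt => e e0; near=> n.
have pn := ltW (isqrt_coef_gt0 n).
rewrite ger0_norm // -(ltr_pXn2r (ltn0Sn 1)) ?nnegrE ?(ltW e0) //.
have n0 : (0 : R) <= n%:R by [].
have en : (e ^+ 2)^-1 <= n%:R by near: n; exact: nbhs_infty_ger.
have : 1 <= n%:R * e ^+ 2 by rewrite -ler_pdivrMr ?exprn_gt0 // mul1r.
have := isqrt_coef_sqr n; have := exprn_gt0 2 (isqrt_coef_gt0 n); have := exprn_gt0 2 e0.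
nra.
Unshelve. all: by end_near. Qed.

(** The Taylor coefficients of (1 - z)^(1/2) = (1 - z) (1 - z)^(-1/2): only the
    first is positive, and their absolute values sum to 2. *)
Definition sqrt_coef (k : nat) : R := if k is j.+1 then p j.+1 - p j else 1.
Local Notation c := sqrt_coef.

Lemma sqrt_coef_sum n : \sum_(0 <= k < n.+1) c k = p n.
Proof.
by elim: n => [|n IH]; rewrite ?big_nat1 // big_nat_recr //= IH addrC subrK.
Qed.

Lemma norm_sqrt_coef k : `|c k| = 2 * (k == 0%N)%:R - c k.
Proof.
case: k => [|k] /=; first by rewrite mulr1 normr1; ring.
by rewrite mulr0 sub0r ler0_norm // subr_le0 isqrt_coef_le.
Qed.

(** The identity (1 - z)^(1/2) (1 - z)^(-1/2) = 1. *)
Lemma sqrt_isqrt_conv n : \sum_(0 <= i < n.+1) c i * p (n - i) = (n == 0%N)%:R.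
Proof.
case: n => [|n]; first by rewrite big_nat1 mulr1.
rewrite big_mkord big_ord_recl mul1r subn0.
under eq_bigr do rewrite lift0 subSS mulrBl.
rewrite sumrB (isqrt_coef_conv n) addrA.
have := isqrt_coef_conv n.+1; rewrite big_ord_recl mul1r subn0.
under eq_bigr do rewrite lift0 subSS.
by move=> ->; rewrite subrr.
Qed.

(** The identity (1 - z)^(1/2) (1 - z)^(1/2) = 1 - z. *)
Lemma sqrt_coef_conv n :
  \sum_(0 <= i < n.+1) c i * c (n - i) = (n == 0%N)%:R - (n == 1%N)%:R.
Proof.
case: n => [|n]; first by rewrite big_nat1 mulr1 subr0.
rewrite big_nat_recr //= subnn mulr1.
rewrite (eq_big_nat _ _ (F2 := fun i => c i * p (n.+1 - i) - c i * p (n - i))).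
  rewrite sumrB sqrt_isqrt_conv.
  have := sqrt_isqrt_conv n.+1; rewrite big_nat_recr //= subnn mulr1 => H.
  by rewrite addrAC H.
by move=> i /andP[_ i_n]; rewrite -mulrBr subSn.
Qed.

(** The mass of the index pairs i, j <= n with i + j > n, which a truncated
    Cauchy square of the series leaves out.  The inner sums telescope, and the
    outer one reduces to the convolution of the two coefficient sequences. *)
Lemma sqrt_coef_tail n : (0 < n)%N ->
  \sum_(0 <= i < n.+1) \sum_(n.+1 - i <= j < n.+1) `|c i| * `|c j| = p n ^+ 2.
Proof.
move=> n0.
have inner i : (0 <= i < n.+1)%N ->
    \sum_(n.+1 - i <= j < n.+1) `|c i| * `|c j| = `|c i| * (p (n - i) - p n).
  move=> /andP[_ i_n]; rewrite -mulr_sumr; congr (_ * _).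
  rewrite subSn // big_add1 /=.
  rewrite -[RHS]opprB -(telescope_sumr p) ?leq_subr // -sumrN.
  by apply: eq_bigr => j _; rewrite ler0_norm // subr_le0 isqrt_coef_le.
rewrite (eq_big_nat _ _ inner).
under eq_bigr do rewrite mulrBr.
rewrite sumrB -mulr_suml.
have atom (f : nat -> R) : \sum_(0 <= i < n.+1) 2 * (i == 0%N)%:R * f i = 2 * f 0%N.
  rewrite big_ltn // mulr1 big_nat_cond big1 ?addr0 // => i /andP[/andP[i0 _] _].
  by rewrite gtn_eqF // mulr0 mul0r.
under eq_bigr do rewrite norm_sqrt_coef mulrBl.
rewrite sumrB (atom (fun i => p (n - i))) sqrt_isqrt_conv subn0.
under eq_bigr do rewrite norm_sqrt_coef -[2 * _]mulr1.
rewrite sumrB (atom (fun=> 1)) sqrt_coef_sum gtn_eqF //=; ring.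
Qed.

Lemma isqrt_coef_powR n : (0 < n)%N -> isqrt_coef n <= 1 / n%:R `^ 2^-1.
Proof.
move=> n_gt0; have pp := isqrt_coef_gt0 n.
have n0 : (0 : R) < n%:R by rewrite ltr0n.
have s0 : 0 < Num.sqrt (n%:R : R) by rewrite sqrtr_gt0.
rewrite powR12_sqrt ?(ltW n0) // ler_pdivlMr //.
rewrite -(expr_le1 (ltn0Sn 1)) ?mulr_ge0 ?(ltW pp) ?(ltW s0) //.
rewrite exprMn sqr_sqrtr ?(ltW n0) //.
have := isqrt_coef_sqr n; have := sqr_ge0 (isqrt_coef n); nra.
Qed.

End SqrtCoefficients.

(** A square of indices is cut along its antidiagonal; the lower half is
    summed by diagonals. *)
Lemma square_sum_split (V : zmodType) (F : nat -> nat -> V) n :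
  \sum_(0 <= i < n) \sum_(0 <= j < n) F i j =
  \sum_(0 <= m < n) \sum_(0 <= i < m.+1) F i (m - i)%N +
  \sum_(0 <= i < n) \sum_(n - i <= j < n) F i j.
Proof.
have triangle m : \sum_(0 <= i < m) \sum_(0 <= j < m - i) F i j =
    \sum_(0 <= k < m) \sum_(0 <= i < k.+1) F i (k - i)%N.
  elim: m => [|m IH]; first by rewrite !big_geq.
  rewrite [RHS]big_nat_recr //= -IH big_nat_recr //= subSnn big_nat1.
  rewrite [X in _ = _ + X]big_nat_recr //= subnn addrA -big_split /=; congr (_ + _).
  apply: eq_big_nat => i /andP[_ im].
  by rewrite subSn ?(ltnW im) // big_nat_recr.
rewrite -triangle -big_split /=; apply: eq_big_nat => i _.
by rewrite -big_cat_nat // leq_subr.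
Qed.

(** * Growth of the harmonic sums *)

Section HarmonicGrowth.
Variable R : realType.

Lemma near_invn (C e : R) : 0 < e -> \forall n \near \oo, C * n%:R^-1 < e.
Proof.
move=> e0; near=> n.
have n0 : (0 < n)%N by near: n; exact: nbhs_infty_gt.
rewrite ltr_pdivrMr ?ltr0n // mulrC -ltr_pdivrMr //.
by near: n; exact: nbhs_infty_gtr.
Unshelve. all: by end_near. Qed.

Lemma cvg_invn (D : R) : D * n%:R^-1 @[n --> \oo] --> (0 : R).
Proof.
apply/cvgr0Pnorm_lt => e e0.
near=> n; rewrite normrM (ger0_norm (_ : 0 <= n%:R^-1)) ?invr_ge0 //.
near: n; exact: near_invn.
Unshelve. all: by end_near. Qed.

Lemma near_le_cvg0 (f g : nat -> R) :
  (forall n, 0 <= f n) -> (\forall n \near \oo, f n <= g n) ->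
  g n @[n --> \oo] --> (0 : R) -> f n @[n --> \oo] --> (0 : R).
Proof.
move=> f0 fg g0; apply: (@squeeze_cvgr _ _ _ _ (fun=> 0) g) => //.
- by near=> n; rewrite f0 /=; near: n.
- exact: cvg_cst.
Unshelve. all: by end_near. Qed.

Definition harmonic_sum n : R := \sum_(1 <= k < n.+1) k%:R^-1.

Lemma harmonic_sum_dvg : harmonic_sum n @[n --> \oo] --> +oo.
Proof.
have hE : harmonic_sum = series (@harmonic R).
  by apply/funext => n; rewrite /harmonic_sum big_add1.
rewrite hE; apply: nondecreasing_dvgn_lt; last exact: dvg_harmonic.
by apply: nondecreasing_series => i _ _; rewrite invr_ge0.
Qed.

(** Each step uses ln (1 - 1/(n+2)) <= - 1/(n+2). *)
Lemma harmonic_sum_ln n : harmonic_sum n.+1 <= 1 + ln n.+1%:R.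
Proof.
elim: n => [|n IH]; first by rewrite /harmonic_sum big_nat1 invr1 ln1 addr0.
rewrite /harmonic_sum big_nat_recr //= -/(harmonic_sum n.+1).
suff H : n.+2%:R^-1 <= ln n.+2%:R - ln n.+1%:R :> R.
  by apply: le_trans (lerD IH H) _; rewrite -addrA [ln n.+1%:R + _]addrC subrK.
have n1 : (0 : R) < n.+1%:R by [].
have n2 : (0 : R) < n.+2%:R by [].
rewrite -opprB lerNr -ln_div ?posrE //.
have -> : n.+1%:R / n.+2%:R = 1 + - n.+2%:R^-1 :> R.
  have frac (a : R) : a + 1 != 0 -> a / (a + 1) = 1 + - (a + 1)^-1 by move=> ?; field.
  by rewrite -(natr1 n.+1); apply: frac; rewrite natr1 lt0r_neq0.
by apply: le_ln1Dx; rewrite ltrN2 invf_lt1 // ltr1n.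
Qed.

(** Sublinearity of ln at n^b gives b ln n <= n^b. *)
Lemma harmonic_sum_powR (b : R) n : 0 < b -> (0 < n)%N ->
  harmonic_sum n <= (1 + b^-1) * n%:R `^ b.
Proof.
move=> b0; case: n => // n _; apply: le_trans (harmonic_sum_ln n) _.
have n1 : (0 : R) < n.+1%:R by [].
have pb : 0 < (n.+1%:R : R) `^ b by rewrite powR_gt0.
rewrite mulrDl mul1r; apply: lerD.
  by rewrite -[leLHS](powRr0 n.+1%:R) ler_powR ?ler1n // ltW.
rewrite ler_pdivlMl // -ln_powR; exact: ltW (ln_sublinear pb).
Qed.

End HarmonicGrowth.

(** * The real-valued norm over real or complex scalars *)

Section RealNorm.
Variables (R : realType) (s : scalars).
Local Notation K := (scalar_field R s).

(** Real numbers as scalars.  Together with [normr_rnorm] this lets every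
    estimate below be made in R, whatever the scalar field is. *)
Definition scalar_of_real : {rmorphism R -> K} :=
  match s return {rmorphism R -> scalar_field R s} with
  | RealScalars => idfun
  | ComplexScalars => real_complex R
  end.
Local Notation emb := scalar_of_real.

Lemma ler_scalar_of_real a b : (emb a <= emb b) = (a <= b).
Proof.
by rewrite /emb; case: (s) => //=; rewrite lecE /= eqxx.
Qed.

Lemma ltr_scalar_of_real a b : (emb a < emb b) = (a < b).
Proof.
by rewrite /emb; case: (s) => //=; rewrite ltcE /= eqxx.
Qed.

Lemma scalar_of_realK a : real_part (emb a) = a.
Proof. by rewrite /emb /real_part; case: (s). Qed.

Lemma real_partK z : 0 <= z -> emb (real_part z) = z.
Proof.
move: z; rewrite /emb /real_part; case: (s) => //= -[x y].
by rewrite lecE /= => /andP[/eqP -> _].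
Qed.

Lemma norm_scalar_of_real a : `|emb a| = emb `|a|.
Proof.
have pos b : 0 <= b -> `|emb b| = emb `|b|.
  by move=> b0; rewrite !ger0_norm // -(rmorph0 emb) ler_scalar_of_real.
case: (lerP 0 a) => [/pos //|a0].
by rewrite -normrN -(normrN a) -rmorphN pos // oppr_ge0 ltW.
Qed.

Variable X : completeNormedModType K.
Implicit Types x y : X.

Lemma normr_rnorm x : `|x| = emb (rnorm x).
Proof. by rewrite /rnorm real_partK. Qed.

Lemma rnorm_ge0 x : 0 <= rnorm x.
Proof. by rewrite -ler_scalar_of_real rmorph0 -normr_rnorm. Qed.

Lemma rnorm0 : rnorm (0 : X) = 0.
Proof. by rewrite /rnorm normr0 -(rmorph0 emb) scalar_of_realK. Qed.

Lemma rnorm_eq0 x : rnorm x = 0 -> x = 0.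
Proof. by move=> h; apply/eqP; rewrite -normr_eq0 normr_rnorm h rmorph0. Qed.

Lemma rnormD x y : rnorm (x + y) <= rnorm x + rnorm y.
Proof. by rewrite -ler_scalar_of_real rmorphD -!normr_rnorm ler_normD. Qed.

Lemma rnormN x : rnorm (- x) = rnorm x.
Proof. by rewrite /rnorm normrN. Qed.

Lemma rnormB x y : rnorm (x - y) <= rnorm x + rnorm y.
Proof. by rewrite -(rnormN y) rnormD. Qed.

Lemma rnorm_distC x y : rnorm (x - y) = rnorm (y - x).
Proof. by rewrite -rnormN opprB. Qed.

Lemma rnormZ a x : rnorm (emb a *: x) = `|a| * rnorm x.
Proof. by rewrite /rnorm normrZ norm_scalar_of_real normr_rnorm -rmorphM !scalar_of_realK. Qed.

Lemma rnormZ_nat (n : nat) x : rnorm (n%:R^-1 *: x) = n%:R^-1 * rnorm x.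
Proof.
have -> : n%:R^-1 = emb n%:R^-1 :> K by rewrite fmorphV rmorph_nat.
by rewrite rnormZ ger0_norm // invr_ge0.
Qed.

Lemma rnorm_sum (I : Type) (r : seq I) (P : pred I) (F : I -> X) :
  rnorm (\sum_(i <- r | P i) F i) <= \sum_(i <- r | P i) rnorm (F i).
Proof.
elim/big_ind2: _ => //; first by rewrite rnorm0.
by move=> x a y b xa yb; apply: le_trans (rnormD _ _) (lerD xa yb).
Qed.

Lemma nbhs_rnormP x (A : set X) :
  nbhs x A <-> exists2 e : R, 0 < e & forall y, rnorm (x - y) < e -> A y.
Proof.
rewrite -nbhs_ballE; split=> [[e /= e0 eA]|[e e0 eA]].
  have ee : emb (real_part e) = e by rewrite real_partK // ltW.
  exists (real_part e); first by rewrite -ltr_scalar_of_real rmorph0 ee.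
  move=> y xy; apply: eA; rewrite -ball_normE /= normr_rnorm.
  by move: xy; rewrite -ltr_scalar_of_real ee.
exists (emb e); first by rewrite /= -(rmorph0 emb) ltr_scalar_of_real.
move=> y; rewrite -ball_normE /= normr_rnorm ltr_scalar_of_real; exact: eA.
Qed.

Lemma cvgn_rnormP (u : nat -> X) x :
  (u n @[n --> \oo] --> x) <->
  (rnorm (u n - x) @[n --> \oo] --> (0 : R)).
Proof.
split=> [ux|ux].
  apply/cvgr0Pnorm_lt => e e0; near=> n.
  rewrite ger0_norm ?rnorm_ge0 // rnorm_distC.
  near: n; apply: (ux (fun y => rnorm (x - y) < e)); apply/nbhs_rnormP.
  by exists e.
move=> A /nbhs_rnormP[e e0 eA].
move/cvgr0Pnorm_lt : ux => /(_ _ e0) ux.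
near=> n; apply: eA; rewrite rnorm_distC -(ger0_norm (rnorm_ge0 _)).
by near: n.
Unshelve. all: by end_near. Qed.

Lemma closure_rnormP (A : set X) x :
  closure A x <-> forall e : R, 0 < e -> exists2 y, A y & rnorm (x - y) < e.
Proof.
split=> [Ax e e0|Ax B /nbhs_rnormP[e e0 eB]].
  have [|y [Ay xy]] := Ax (fun y => rnorm (x - y) < e); last by exists y.
  by apply/nbhs_rnormP; exists e.
by have [y Ay xy] := Ax e e0; exists y; split=> //; apply: eB.
Qed.

(** Completeness in the form used throughout: increments dominated by those of
    a scalar sequence tending to 0.  This covers geometric series as well as
    the telescoping majorants given by [isqrt_coefB], and yields the error
    bound at the same time. *)
Lemma cvgn_telescope (u : nat -> X) (b : nat -> R) :
  (forall n, rnorm (u n.+1 - u n) <= b n - b n.+1) ->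
  b n @[n --> \oo] --> (0 : R) ->
  exists2 l : X, u n @[n --> \oo] --> l & forall n, rnorm (l - u n) <= b n.
Proof.
move=> ub b0.
have dist m k : rnorm (u (m + k)%N - u m) <= b m - b (m + k)%N.
  elim: k => [|k IH]; first by rewrite addn0 !subrr rnorm0.
  rewrite addnS -(subrKA (u (m + k)%N)).
  apply: le_trans (rnormD _ _) _; apply: le_trans (lerD (ub _) IH) _.
  by rewrite addrC subrKA.
have bdec m k : b (m + k)%N <= b m.
  by have := le_trans (rnorm_ge0 _) (dist m k); rewrite subr_ge0.
have b_ge0 m : 0 <= b m.
  rewrite -(cvg_lim _ b0)//; apply: nonincreasing_cvgn_ge; last exact: cvgP b0.
  by move=> i j ij; rewrite -(subnKC ij).
have /cauchy_cvgP ucvg : cauchy (u n @[n --> \oo]).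
  apply: cauchy_exP => e e0.
  have ee : emb (real_part e) = e by rewrite real_partK // ltW.
  have re0 : 0 < real_part e by rewrite -ltr_scalar_of_real rmorph0 ee.
  move/cvgr0Pnorm_lt : b0 => /(_ _ re0)[m _ bm].
  exists (u m); exists m => // n /= mn; rewrite -ball_normE /= normr_rnorm -ee ltr_scalar_of_real.
  rewrite rnorm_distC -(subnKC mn); apply: le_lt_trans (dist _ _) _.
  apply: le_lt_trans (bm m (leqnn m)).
  by rewrite (ger0_norm (b_ge0 _)) gerBl.
exists (lim (u n @[n --> \oo])) => // m.
move/cvgn_rnormP/cvgr0Pnorm_lt : (ucvg) => ul.
apply/ler_addgt0Pr => e /ul [k _ uk].
set l := lim _; rewrite (_ : l - u m = (u (m + k)%N - u m) - (u (m + k)%N - l)); last first.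
  by rewrite opprB [RHS]addrC addrA subrK.
apply: le_trans (rnormB _ _) _; apply: lerD.
  by apply: le_trans (dist _ _) _; rewrite gerBl.
by have := uk _ (leq_addl m k); rewrite (ger0_norm (rnorm_ge0 _)) => /ltW.
Qed.

Lemma rnorm_le_opnorm (S : X -> X) (C : R) :
  (forall (a : R) x, S (emb a *: x) = emb a *: S x) ->
  (opnorm S <= C%:E)%E -> forall x, rnorm (S x) <= C * rnorm x.
Proof.
move=> SZ SC x; have unit_ball y : rnorm y <= 1 -> rnorm (S y) <= C.
  by move=> y1; rewrite -lee_fin; apply: le_trans SC; apply: ereal_sup_ubound; exists y.
have [x0|x0] := eqVneq (rnorm x) 0.
  have S0 : S 0 = 0 by have := SZ 0 0; rewrite rmorph0 !scale0r.
  by rewrite (rnorm_eq0 x0) S0 rnorm0 mulr0.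
have xp : 0 < rnorm x by rewrite lt_def x0 rnorm_ge0.
rewrite -ler_pdivrMr // mulrC.
have := unit_ball (emb (rnorm x)^-1 *: x).
rewrite SZ !rnormZ ger0_norm ?invr_ge0 ?rnorm_ge0 // mulVf //; exact.
Qed.

Lemma opnorm_ge0 (S : X -> X) : (0 <= opnorm S)%E.
Proof.
apply: (@le_trans _ _ (rnorm (S 0))%:E); first by rewrite lee_fin rnorm_ge0.
by apply: ereal_sup_ubound; exists 0 => //=; rewrite rnorm0.
Qed.

Lemma opnorm_le (S : X -> X) (D : R) : 0 <= D ->
  (forall x, rnorm (S x) <= D * rnorm x) -> (opnorm S <= D%:E)%E.
Proof.
move=> D0 SD; apply: ub_ereal_sup => _ [x /= x1 <-]; rewrite lee_fin.
by apply: le_trans (SD x) _; rewrite ler_piMr.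
Qed.

Lemma power_boundedP (T : {linear X -> X}) : power_bounded T ->
  exists2 C : R, 1 <= C & forall n x, rnorm (iter n T x) <= C * rnorm x.
Proof.
rewrite /power_bounded; set B := ereal_sup _ => Tb.
have TZ n (a : R) x : iter n T (emb a *: x) = emb a *: iter n T x.
  by elim: n => //= n ->; rewrite linearZ.
pose C : R := Num.max 1 (fine B).
have BC : (B <= C%:E)%E.
  rewrite /C; case: B {C} Tb => [r| |] //= _; last by rewrite leNye.
  by rewrite lee_fin le_max lexx orbT.
exists C; first by rewrite le_max lexx.
move=> n; apply: rnorm_le_opnorm; first exact: TZ.
by apply: le_trans BC; apply: ereal_sup_ubound; exists n.
Qed.

Lemma cvgn_lipschitz (S : {linear X -> X}) (D : R) (u : nat -> X) l :
  (forall x, rnorm (S x) <= D * rnorm x) ->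
  u n @[n --> \oo] --> l -> S (u n) @[n --> \oo] --> S l.
Proof.
move=> SD /cvgn_rnormP ul; apply/cvgn_rnormP.
apply: (@squeeze_cvgr _ _ _ _ (fun=> 0) (fun n => D * rnorm (u n - l))).
- by near=> n; rewrite rnorm_ge0 -linearB SD.
- exact: cvg_cst.
- by rewrite -(mulr0 D); apply: cvgMl_tmp.
Unshelve. all: by end_near. Qed.

End RealNorm.

(** * Ergodic means of a power-bounded operator *)

Section PowerBounded.
Variables (R : realType) (s : scalars).
Local Notation K := (scalar_field R s).
Local Notation emb := (scalar_of_real R s).
Variable X : completeNormedModType K.
Implicit Types x y : X.
Variables (T : {linear X -> X}) (C : R).
Hypothesis C1 : 1 <= C.
Hypothesis TC : forall n x, rnorm (iter n T x) <= C * rnorm x.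
Local Notation M := (ergodic_mean T).

Let C0 : 0 <= C. Proof. exact: le_trans C1. Qed.

Fact iter_is_linear n : linear (iter n T).
Proof. by elim: n => [|n IH] a x y //=; rewrite [iter n T _](IH a x y) linearP. Qed.

HB.instance Definition _ n := GRing.isLinear.Build _ _ _ _ _ (iter_is_linear n).

Fact ergodic_mean_is_linear n : linear (M n).
Proof.
move=> a x y; rewrite /ergodic_mean scalerA mulrC -scalerA -scalerDr.
congr (_ *: _); rewrite scaler_sumr -big_split; apply: eq_bigr => k _.
exact: (linearP (iter k T)).
Qed.

HB.instance Definition _ n := GRing.isLinear.Build _ _ _ _ _ (ergodic_mean_is_linear n).

Lemma rnorm_mean n x : rnorm (M n x) <= C * rnorm x.
Proof.
rewrite /ergodic_mean rnormZ_nat; case: n => [|n].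
  by rewrite invr0 mul0r mulr_ge0 ?rnorm_ge0.
rewrite mulrC ler_pdivrMr ?ltr0n //; apply: le_trans (rnorm_sum _ _ _) _.
apply: (le_trans (ler_sum_nat (fun k _ => TC k x))).
by rewrite sumr_const_nat subSS subn0 mulr_natr.
Qed.

Lemma mean_sub_T n x : M n (x - T x) = n%:R^-1 *: (T x - iter n.+1 T x).
Proof.
rewrite /ergodic_mean; congr (_ *: _).
rewrite -[RHS]opprB -[T x]/(iter 1 T x) -(telescope_sumr (fun k => iter k T x)) //.
by rewrite -sumrN; apply: eq_bigr => k _; rewrite opprB (linearB (iter k T)) /= -iterSr.
Qed.

Lemma rnorm_mean_sub_T n x : rnorm (M n (x - T x)) <= 2 * C * n%:R^-1 * rnorm x.
Proof.
rewrite mean_sub_T rnormZ_nat mulrAC mulrC ler_wpM2r ?invr_ge0 //.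
apply: le_trans (rnormB _ _) _; rewrite -mulrA mulr2n mulrDl mul1r.
by apply: lerD; [exact: (TC 1)|exact: TC].
Qed.

Lemma sub_iter k x :
  x - iter k T x = \sum_(0 <= i < k) (iter i T x - T (iter i T x)).
Proof.
have /= tele := telescope_sumr (fun i => iter i T x) (leq0n k).
rewrite -[LHS]opprB -tele -sumrN.
by apply: eq_bigr => i _; rewrite opprB.
Qed.

Lemma rnorm_mean_sub_iter n k x :
  rnorm (M n (x - iter k T x)) <= 2 * C ^+ 2 * n%:R^-1 * k%:R * rnorm x.
Proof.
rewrite sub_iter linear_sum; apply: le_trans (rnorm_sum _ _ _) _ => /=.
have step i : rnorm (M n (iter i T x - T (iter i T x))) <= 2 * C ^+ 2 * n%:R^-1 * rnorm x.
  apply: le_trans (rnorm_mean_sub_T n _) _.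
  have -> : 2 * C ^+ 2 * n%:R^-1 * rnorm x = 2 * C * n%:R^-1 * (C * rnorm x) by ring.
  by rewrite ler_wpM2l // ?TC // !mulr_ge0 // invr_ge0.
apply: (le_trans (ler_sum_nat (fun i _ => step i))).
by rewrite sumr_const_nat subn0 -[_ *+ k]mulr_natr mulrAC.
Qed.

Definition hilbert_sum n x : X := \sum_(1 <= k < n.+1) k%:R^-1 *: iter k T x.

(** For k <= n, M_n and M_n T^k differ by O(k / n); summed with weights 1 / k,
    these errors stay bounded, so M_n (hilbert_sum n x) is
    harmonic_sum n *: M n x up to O(N(x)). *)
Lemma harmonic_mean_le n x :
  harmonic_sum R n * rnorm (M n x) <= C * rnorm (hilbert_sum n x) + 2 * C ^+ 2 * rnorm x.
Proof.
have h0 : 0 <= harmonic_sum R n by apply: sumr_ge0 => k _; rewrite invr_ge0.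
rewrite -{1}(ger0_norm h0) -rnormZ.
have -> : emb (harmonic_sum R n) *: M n x =
    M n (hilbert_sum n x) + \sum_(1 <= k < n.+1) k%:R^-1 *: M n (x - iter k T x).
  rewrite linear_sum /= -big_split /= rmorph_sum scaler_suml /=.
  apply: eq_bigr => k _; rewrite (linearZ_LR (M n)) (linearB (M n)) /= scalerBr addrC subrK.
  by rewrite fmorphV rmorph_nat.
apply: le_trans (rnormD _ _) (lerD (rnorm_mean _ _) _).
apply: le_trans (rnorm_sum _ _ _) _.
apply: (@le_trans _ _ (\sum_(1 <= k < n.+1) 2 * C ^+ 2 * n%:R^-1 * rnorm x)).
  apply: ler_sum_nat => k /andP[k1 kn]; rewrite rnormZ_nat.
  apply: le_trans (ler_wpM2l _ (rnorm_mean_sub_iter n k x)) _.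
    by rewrite invr_ge0.
  have k0 : k%:R != 0 :> R by rewrite pnatr_eq0 -lt0n.
  have n0 : n%:R != 0 :> R by rewrite pnatr_eq0 -lt0n (leq_trans k1).
  by rewrite le_eqVlt; apply/orP; left; apply/eqP; field; apply/andP.
rewrite sumr_const_nat subSS subn0; case: n {h0} => [|n].
  by rewrite mulr0n !mulr_ge0 // ?rnorm_ge0 // exprn_ge0.
have : n.+1%:R != 0 :> R by rewrite pnatr_eq0.
rewrite -[_ * rnorm x *+ _]mulr_natr; move: n.+1%:R => d d0.
by rewrite le_eqVlt; apply/orP; left; apply/eqP; field.
Qed.

(** The operator S_n with (I - T) S_n = I - M_n: each I - T^k factors as
    I - T times the sum of the first k powers of T. *)
Definition mean_potential n x : X :=
  n%:R^-1 *: \sum_(1 <= k < n.+1) \sum_(0 <= i < k) iter i T x.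

Fact mean_potential_is_linear n : linear (mean_potential n).
Proof.
move=> a x y; rewrite /mean_potential scalerA mulrC -scalerA -scalerDr.
congr (_ *: _); rewrite scaler_sumr -big_split; apply: eq_bigr => k _.
rewrite /= scaler_sumr -big_split; apply: eq_bigr => i _.
exact: (linearP (iter i T)).
Qed.

HB.instance Definition _ n :=
  GRing.isLinear.Build _ _ _ _ _ (mean_potential_is_linear n).

Lemma mean_potential_T n x : mean_potential n (T x) = T (mean_potential n x).
Proof.
rewrite /mean_potential (linearZ_LR T) (linear_sum T); congr (_ *: _).
apply: eq_bigr => k _; rewrite (linear_sum T).
by apply: eq_bigr => i _; rewrite -iterSr.
Qed.

Lemma mean_potential_sub n x : (0 < n)%N ->
  mean_potential n x - T (mean_potential n x) = x - M n x.
Proof.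
move=> n0; have n0' : n%:R != 0 :> K by rewrite pnatr_eq0 -lt0n.
have -> : x - M n x = n%:R^-1 *: (n%:R *: x - \sum_(1 <= k < n.+1) iter k T x).
  by rewrite scalerBr scalerK.
rewrite /mean_potential (linearZ_LR T) -scalerBr (linear_sum T) -sumrB.
congr (_ *: _); have -> : n%:R *: x = \sum_(1 <= k < n.+1) x.
  by rewrite sumr_const_nat subSS subn0 scaler_nat.
rewrite -sumrB; apply: eq_bigr => k _.
by rewrite sub_iter (linear_sum T) -sumrB.
Qed.

Lemma rnorm_mean_potential n x : rnorm (mean_potential n x) <= n%:R * C * rnorm x.
Proof.
rewrite rnormZ_nat; case: n => [|n]; first by rewrite invr0 !mul0r.
rewrite mulrC ler_pdivrMr ?ltr0n //.
apply: le_trans (rnorm_sum _ _ _) _.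
apply: (@le_trans _ _ (\sum_(1 <= k < n.+2) n.+1%:R * C * rnorm x)).
  apply: ler_sum_nat => k /andP[_ kn]; apply: le_trans (rnorm_sum _ _ _) _.
  apply: (le_trans (ler_sum_nat (fun i _ => TC i x))).
  rewrite sumr_const_nat subn0 -[_ * _ *+ k]mulr_natl -mulrA ler_wpM2r ?ler_nat //.
  by rewrite mulr_ge0 ?rnorm_ge0.
by rewrite sumr_const_nat subSS subn0 mulr_natr.
Qed.

Local Notation Y := (closure (range_I_minus T)).

(** Left to right, M_n tends to 0 on the range of I - T and the M_n are
    uniformly bounded.  Right to left, y - M_n y = (I - T) S_n y belongs to the
    range and tends to y. *)
Lemma closure_range_cvg y : Y y <-> M n y @[n --> \oo] --> (0 : X).
Proof.
split=> [/closure_rnormP Yy|My].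
  apply/cvgn_rnormP/cvgr0Pnorm_lt => e e0.
  have [_ [x _ <-] yx] := Yy (e / (2 * C)) ltac:(by rewrite divr_gt0 // mulr_gt0 // (lt_le_trans _ C1)).
  have := near_invn (2 * C * rnorm x) (divr_gt0 e0 (ltr0Sn _ 1)); apply: filterS => n nx.
  rewrite ger0_norm ?rnorm_ge0 // subr0 -(subrK (x - T x) y) linearD.
  apply: le_lt_trans (rnormD _ _) _; rewrite (splitr e); apply: ltr_leD.
    apply: le_lt_trans (rnorm_mean _ _) _.
    by move: yx; rewrite ltr_pdivlMr ?mulr_gt0 ?(lt_le_trans _ C1) // => yx; lra.
  by apply: le_trans (rnorm_mean_sub_T _ _) _; rewrite mulrAC ltW.
apply/closure_rnormP => e e0.
move/cvgn_rnormP/cvgr0Pnorm_lt : My => /(_ _ e0) [n _ Mn].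
exists (y - M n.+1 y).
  by exists (mean_potential n.+1 y) => //; rewrite mean_potential_sub.
rewrite opprB addrC subrK; have := Mn n.+1 (leqnSn n).
by rewrite subr0 ger0_norm ?rnorm_ge0.
Qed.

(** * Contraction of the means and uniform ergodicity *)

Lemma mean_T n x : M n (T x) = T (M n x).
Proof.
rewrite /ergodic_mean (linearZ_LR T) (linear_sum T); congr (_ *: _).
by apply: eq_bigr => k _; rewrite -iterSr.
Qed.

Lemma range_closure x : Y (x - T x).
Proof. by apply: subset_closure; exists x. Qed.

Lemma closure_range0 : Y 0.
Proof. by have := @range_closure 0; rewrite linear0 subr0. Qed.

Lemma closure_rangeD x y : Y x -> Y y -> Y (x + y).
Proof.
move=> /closure_range_cvg Yx /closure_range_cvg Yy.
apply/closure_range_cvg; rewrite -(addr0 0).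
under eq_cvg do rewrite linearD; exact: cvgD.
Qed.

Lemma closure_rangeZ a x : Y x -> Y (a *: x).
Proof.
move=> /closure_range_cvg Yx; apply/closure_range_cvg.
rewrite -(scaler0 _ a); under eq_cvg do rewrite linearZ_LR; exact: cvgZl_tmp.
Qed.

Lemma closure_range_mean n y : Y y -> Y (M n y).
Proof.
move=> /closure_rnormP Yy; apply/closure_rnormP => e e0.
have Cp : 0 < C by rewrite (lt_le_trans _ C1).
have [_ [x _ <-] yx] := Yy _ (divr_gt0 e0 Cp).
exists (M n (x - T x)); first by exists (M n x) => //; rewrite linearB /= mean_T.
rewrite -linearB; apply: le_lt_trans (rnorm_mean _ _) _.
by rewrite mulrC -ltr_pdivlMr.
Qed.

Definition mean_contraction : Prop :=
  exists2 n, (0 < n)%N & forall y, Y y -> rnorm (M n y) <= 2^-1 * rnorm y.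

(** The Neumann series u of the iterates of M_n on Y satisfies
    u - M_n u = y, and I - M_n = (I - T) S_n.  That u stays in Y allows the
    construction to be repeated. *)
Lemma contraction_preimage n : (0 < n)%N ->
  (forall y, Y y -> rnorm (M n y) <= 2^-1 * rnorm y) ->
  forall y, Y y -> exists u, [/\ Y u, rnorm u <= 2 * rnorm y &
    y = mean_potential n u - T (mean_potential n u)].
Proof.
move=> n0 Mn y Yy.
pose t i := iter i (M n) y.
have Yt i : Y (t i) by elim: i => //= i; exact: closure_range_mean.
have Nt i : rnorm (t i) <= 2^-1 ^+ i * rnorm y.
  elim: i => [|i IH]; first by rewrite mul1r.
  by rewrite exprS -mulrA; apply: le_trans (Mn _ (Yt i)) _; rewrite ler_wpM2l // invr_ge0.
pose u j := \sum_(0 <= i < j) t i.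
have exp0 (D : R) : 2^-1 ^+ j * D @[j --> \oo] --> (0 : R).
  rewrite -(mul0r D); apply: cvgMr_tmp; apply: cvg_expr.
  by rewrite ger0_norm ?invr_ge0 // invf_lt1 // ltr1n.
have [j|l ul lu] := @cvgn_telescope _ _ _ u (fun j => 2^-1 ^+ j * (2 * rnorm y)) _ (exp0 _).
  rewrite /u big_nat_recr //= addrAC subrr add0r; apply: le_trans (Nt j) _.
  by rewrite exprS le_eqVlt; apply/orP; left; apply/eqP; field.
exists l; split.
- apply: (closed_cvg Y) ul; first exact: closed_closure.
  near=> j; rewrite /u big_mkord; apply: big_ind => //; first exact: closure_range0.
  exact: closure_rangeD.
- by have := lu 0; rewrite /u big_geq // subr0 mul1r.
rewrite (mean_potential_sub l n0).
have uM j : u j - M n (u j) = y - t j.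
  rewrite /u linear_sum -sumrB /=.
  have tele : \sum_(0 <= i < j) (t i.+1 - t i) = t j - y := telescope_sumr t (leq0n j).
  rewrite -[RHS]opprB -tele -sumrN.
  by apply: eq_bigr => i _; rewrite opprB.
have ul' : u j - M n (u j) @[j --> \oo] --> l - M n l.
  by apply: cvgB => //; apply: (cvgn_lipschitz (rnorm_mean n)).
have uy : u j - M n (u j) @[j --> \oo] --> y.
  under eq_cvg do rewrite uM.
  apply/cvgn_rnormP; apply: (@squeeze_cvgr _ _ _ _ (fun=> 0) (fun j => 2^-1 ^+ j * rnorm y)).
  - by near=> j; rewrite rnorm_ge0 addrAC subrr add0r rnormN Nt.
  - exact: cvg_cst.
  - exact: exp0.
exact: (cvg_unique _ uy ul').
Unshelve. all: by end_near. Qed.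

Lemma contraction_closed_range : mean_contraction -> Y = range_I_minus T.
Proof.
case=> n n0 Mn; apply/seteqP; split; last exact: subset_closure.
move=> y /(contraction_preimage n0 Mn)[u [_ _ ->]].
by exists (mean_potential n u).
Qed.

Lemma mean_fixed n f : (0 < n)%N -> T f = f -> M n f = f.
Proof.
move=> n0 Tf; have iterf k : iter k T f = f by elim: k => //= k ->.
rewrite /ergodic_mean; under eq_bigr do rewrite iterf.
by rewrite sumr_const_nat subSS subn0 -[f *+ n]scaler_nat scalerK // pnatr_eq0 -lt0n.
Qed.

(** Here x - T x = (I - T) S_n u with u in Y, so f = x - S_n u is fixed; and
    applying the preimage construction again, to u, gives
    u = (I - T) S_n u' and S_n u = (I - T) v with v = S_n S_n u'.  Thus M_m x - f = M_m (I - T) v. *)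
Lemma contraction_mean_rate : mean_contraction ->
  exists2 D : R, 0 <= D & forall x, exists f, forall m, (0 < m)%N ->
    rnorm (M m x - f) <= D * m%:R^-1 * rnorm x.
Proof.
case=> n n0 Mn; have preim := contraction_preimage n0 Mn.
pose S := mean_potential n.
have [B B0 NS] : exists2 B : R, 0 <= B & forall x, rnorm (S x) <= B * rnorm x.
  by exists (n%:R * C); [rewrite mulr_ge0|exact: rnorm_mean_potential].
exists (2 * C * (B * (B * (2 * (2 * (1 + C)))))).
  by rewrite !(mulr_ge0, addr_ge0).
move=> x; have [u [Yu Nu xu]] := preim _ (@range_closure x).
have [u' [_ Nu' uu']] := preim _ Yu.
pose v := S (S u').
have wv : S u = v - T v by rewrite [in LHS]uu' /v /S (linearB (mean_potential n)) /= mean_potential_T.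
exists (x - S u) => m m0.
have fixf : T (x - S u) = x - S u.
  apply/eqP; rewrite linearB /= -subr_eq0 -oppr_eq0 opprB.
  rewrite (_ : _ - _ = (x - T x) - (S u - T (S u))); first by rewrite xu subrr.
  by rewrite !opprB addrACA [in RHS]addrACA [- S u - T x]addrC.
rewrite -[X in _ - X](mean_fixed m0 fixf) -linearB opprB addrC subrK wv /=.
apply: le_trans (rnorm_mean_sub_T m v) _.
have Nv : rnorm v <= B * (B * (2 * (2 * (1 + C)))) * rnorm x.
  rewrite -!mulrA; apply: le_trans (NS _) _; rewrite ler_wpM2l //.
  apply: le_trans (NS _) _; rewrite ler_wpM2l //.
  apply: le_trans Nu' _; rewrite ler_wpM2l //; apply: le_trans Nu _; rewrite ler_wpM2l //.
  by apply: le_trans (rnormB _ _) _; rewrite mulrDl mul1r lerD2l (TC 1).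
apply: (@le_trans _ _ (2 * C * m%:R^-1 * (B * (B * (2 * (2 * (1 + C)))) * rnorm x))).
  by rewrite ler_wpM2l // !mulr_ge0 // invr_ge0.
by rewrite le_eqVlt; apply/orP; left; apply/eqP; ring.
Qed.

Lemma contraction_uniformly_ergodic : mean_contraction -> uniformly_ergodic T.
Proof.
move=> /contraction_mean_rate[D D0 /choice[E ME]].
have EM x : M m x @[m --> \oo] --> E x.
  apply/cvgn_rnormP; apply: near_le_cvg0 (cvg_invn (D * rnorm x)) => [n|].
    exact: rnorm_ge0.
  near=> m; rewrite mulrAC; apply: ME.
  by near: m; exact: nbhs_infty_gt.
have Elin : linear E.
  move=> a x y; have L : M m (a *: x + y) @[m --> \oo] --> a *: E x + E y.
    under eq_cvg do rewrite linearD linearZ_LR; exact: (cvgD (cvgZl_tmp (EM x)) (EM y)).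
  exact: (cvg_unique _ (EM _) L).
pose E' : {linear X -> X} := HB.pack E (GRing.isLinear.Build _ _ _ _ _ Elin).
exists E'; split.
  apply: (@le_lt_trans _ _ (D + C)%:E); last exact: ltry.
  apply: opnorm_le => [|x]; first exact: addr_ge0.
  rewrite -[E' x]/(E x) -(subrK (M 1%N x) (E x)) mulrDl.
  apply: le_trans (rnormD _ _) _; apply: lerD; last exact: rnorm_mean.
  by rewrite rnorm_distC; apply: le_trans (ME x 1%N isT) _; rewrite invr1 mulr1.
apply: (@squeeze_cvge _ _ _ _ (fun=> 0%E) _ (fun m => (D * m%:R^-1)%:E)).
- near=> m; rewrite opnorm_ge0 /=; apply: opnorm_le => [|x].
    by rewrite mulr_ge0 // invr_ge0.
  by apply: ME; near: m; exact: nbhs_infty_gt.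
- exact: cvg_cst.
- by apply: cvg_EFin; [near=> m|exact: cvg_invn].
Unshelve. all: by end_near. Qed.

(** The limit E vanishes on Y, where M_n y tends to 0; so the norm of M_n - E
    bounds that of M_n on Y. *)
Lemma uniformly_ergodic_contraction : uniformly_ergodic T -> mean_contraction.
Proof.
case=> E [_ /fine_cvgP[Mfin Mcvg]].
have close e : 0 < e -> \forall n \near \oo, forall x, rnorm (M n x - E x) <= e * rnorm x.
  move=> e0; move/cvgr0Pnorm_lt : Mcvg => /(_ _ e0) Mcvg.
  near=> n; apply: rnorm_le_opnorm.
    by move=> a x; rewrite (linearZ_LR (M n)) (linearZ_LR E) -scalerBr.
  have fn : opnorm (fun x => M n x - E x) \is a fin_num by near: n.
  rewrite -(fineK fn) lee_fin; apply: le_trans (ler_norm _) _.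
  by apply: ltW; near: n.
have EY y : Y y -> E y = 0.
  move=> /closure_range_cvg My.
  have ME : M n y @[n --> \oo] --> E y.
    apply/cvgn_rnormP/cvgr0Pnorm_lt => e e0.
    have := close (e / (1 + rnorm y)) ltac:(by rewrite divr_gt0 // ltr_pwDl ?rnorm_ge0).
    apply: filterS => n /(_ y) nE; rewrite ger0_norm ?rnorm_ge0 //.
    apply: le_lt_trans nE _; rewrite mulrAC ltr_pdivrMr ?ltr_pwDl ?rnorm_ge0 //.
    by rewrite ltr_pM2l // ltrDr.
  exact: (cvg_unique _ ME My).
have [n _ nE] := close 2^-1 ltac:(by rewrite invr_gt0).
exists n.+1 => // y Yy; have := nE n.+1 (leqnSn n) y.
by rewrite EY // subr0.
Unshelve. all: by end_near. Qed.

(** * From pointwise rates to contraction: a gliding hump *)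

(** If no M_n contracts Y, there are unit vectors y_j in Y and n_j with
    N(M_(n_j) y_j) > 1/2.  In the sum l of e^j y_j, choosing n_j large makes
    the preceding partial sum, an element of Y, negligible under M_(n_j), and
    makes a_(n_j) e^j at least j; choosing e small against C makes the tail
    negligible.  Hence N(M_(n_j) l) >= e^j / 4 and a_(n_j) N(M_(n_j) l) is
    unbounded. *)
Lemma divergent_rate_contraction (a : nat -> R) :
  a n @[n --> \oo] --> +oo ->
  (forall y, Y y -> exists B, \forall n \near \oo, a n * rnorm (M n y) <= B) ->
  mean_contraction.
Proof.
move=> a_oo aM; apply: contrapT => notQ.
have large n : (0 < n)%N -> exists y, [/\ Y y, rnorm y = 1 & 2^-1 < rnorm (M n y)].
  move=> n0; apply: contrapT => H; apply: notQ; exists n => // y Yy.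
  rewrite leNgt; apply/negP => yM; apply: H.
  have [y0|y0] := eqVneq (rnorm y) 0.
    by move: yM; rewrite (rnorm_eq0 y0) linear0 rnorm0 mulr0 ltxx.
  have yp : 0 < rnorm y by rewrite lt_def y0 rnorm_ge0.
  exists (emb (rnorm y)^-1 *: y); split; first exact: closure_rangeZ.
    by rewrite rnormZ ger0_norm ?invr_ge0 ?rnorm_ge0 // mulVf.
  rewrite (linearZ_LR (M n)) rnormZ ger0_norm ?invr_ge0 ?rnorm_ge0 //.
  by rewrite mulrC ltr_pdivlMr.
(* This ratio makes C times the tail e^(j+1) / (1 - e) equal to e^j / 8. *)
pose e : R := (8 * C + 1)^-1.
have C8 : 0 < 8 * C + 1 by rewrite ltr_wpDl // mulr_ge0.
have e0 : 0 < e by rewrite invr_gt0.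
have e1 : e < 1 by rewrite invf_lt1 // ltrDr mulr_gt0 // (lt_le_trans _ C1).
(* The default pair only makes the choice total; Y x holds where it is used. *)
have step (j : nat) x : exists p : nat * X, Y x ->
    [/\ (j < p.1)%N, Y p.2, rnorm p.2 = 1, 2^-1 < rnorm (M p.1 p.2) &
      rnorm (M p.1 x) <= e ^+ j / 8 /\ j%:R <= a p.1 * e ^+ j].
  have [Yx|nYx] := pselect (Y x); last by exists (0%N, x).
  have ej : 0 < e ^+ j by rewrite exprn_gt0.
  move/closure_range_cvg/cvgn_rnormP/cvgr0Pnorm_lt : (Yx) => Mx.
  have ej8 : 0 < e ^+ j / 8 by rewrite divr_gt0.
  have near_n : \forall n \near \oo,
      [/\ (j < n)%N, rnorm (M n x) <= e ^+ j / 8 & j%:R <= a n * e ^+ j].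
    near=> n; split.
    - by near: n; exact: nbhs_infty_gt.
    - rewrite -[leLHS]ger0_norm ?rnorm_ge0 // -[M n x]subr0 ltW //.
      by near: n; exact: Mx.
    - rewrite -ler_pdivrMr //; near: n; exact: (cvgryPge _).1.
  have [n [jn Mn an]] := filter_ex near_n.
  have [y [Yy y1 My]] := large n (leq_ltn_trans (leq0n j) jn).
  by exists (n, y).
have /choice[f fP] : forall q : nat * X, exists p : nat * X, Y q.2 ->
    [/\ (q.1 < p.1)%N, Y p.2, rnorm p.2 = 1, 2^-1 < rnorm (M p.1 p.2) &
      rnorm (M p.1 q.2) <= e ^+ q.1 / 8 /\ q.1%:R <= a p.1 * e ^+ q.1].
  by move=> [j x]; exact: step.
pose u := fix u j := if j is i.+1 then u i + emb (e ^+ i) *: (f (i, u i)).2 else 0.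
have Yu j : Y (u j).
  elim: j => [|j IH] /=; first exact: closure_range0.
  have [_ Yf _ _ _] := fP (j, u j) IH.
  by apply: closure_rangeD => //; exact: closure_rangeZ.
have uS j : u j.+1 - u j = emb (e ^+ j) *: (f (j, u j)).2 by rewrite /= addrC addKr.
have e1n : 1 - e != 0 by rewrite subr_eq0 gt_eqF.
have [j||l ul lu] := @cvgn_telescope _ _ _ u (fun j => e ^+ j / (1 - e)).
- have [_ _ f1 _ _] := fP (j, u j) (Yu j).
  rewrite uS rnormZ f1 mulr1 ger0_norm ?exprn_ge0 ?(ltW e0) // exprS.
  by rewrite le_eqVlt; apply/orP; left; apply/eqP; field.
- rewrite -(mul0r (1 - e)^-1); apply: cvgMr_tmp; apply: cvg_expr.
  by rewrite ger0_norm ?(ltW e0).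
have Yl : Y l.
  by apply: (closed_cvg Y) ul; [exact: closed_closure|near=> j].
have [B [m _ aB]] := aM l Yl.
pose j := (maxn m (Num.truncn (4 * `|B|)).+1).
have [jn Yf f1 Mf [Mu aj]] := fP (j, u j) (Yu j).
set n := (f (j, u j)).1 in jn Mf Mu aj; set y := (f (j, u j)).2 in Yf f1 Mf.
move: jn Mu aj => /= jn Mu aj.
have ej : 0 < e ^+ j by rewrite exprn_gt0.
have Mn : e ^+ j / 4 <= rnorm (M n l).
  have tail : rnorm (M n (l - u j.+1)) <= e ^+ j / 8.
    apply: le_trans (rnorm_mean _ _) _.
    apply: le_trans (ler_wpM2l C0 (lu j.+1)) _.
    have -> : C * (e ^+ j.+1 / (1 - e)) = e ^+ j * (C * (e / (1 - e))).
      by rewrite exprS; field.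
    have -> : C * (e / (1 - e)) = 8^-1; last by [].
    rewrite /e; field; apply/andP; split; first by rewrite gt_eqF.
    by rewrite addrK gt_eqF // mulr_gt0 // (lt_le_trans _ C1).
  have main : e ^+ j / 2 <= rnorm (M n (emb (e ^+ j) *: y)).
    rewrite (linearZ_LR (M n)) rnormZ ger0_norm ?exprn_ge0 ?(ltW e0) //.
    by rewrite ler_wpM2l // ltW.
  have split : M n (emb (e ^+ j) *: y) = M n l - M n (l - u j.+1) - M n (u j).
    by rewrite -uS -!linearB; congr (M n _); rewrite opprB addrCA subrr addr0.
  have := rnormB (M n l - M n (l - u j.+1)) (M n (u j)); rewrite -split.
  have := rnormB (M n l) (M n (l - u j.+1)).
  lra.
have Bn := aB n (leq_trans (leq_maxl _ _) (ltnW jn)).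
have a0 : 0 <= a n by rewrite -(pmulr_lge0 _ ej); apply: le_trans aj.
have := ler_wpM2l a0 Mn.
have B4 : 4 * `|B| < j%:R.
  by apply: lt_le_trans (truncnS_gt _) _; rewrite ler_nat leq_maxr.
have := ler_norm B.
rewrite mulrA; lra.
Unshelve. all: by end_near. Qed.

(** * A square root of I - T *)

Local Notation p := (@isqrt_coef R).
Local Notation c := (sqrt_coef R).

Let p0 n : 0 <= p n. Proof. exact: ltW (isqrt_coef_gt0 _ _). Qed.

Definition sqrt_sum n x : X := \sum_(0 <= k < n.+1) emb (c k) *: iter k T x.

Fact sqrt_sum_is_linear n : linear (sqrt_sum n).
Proof.
move=> a x y; rewrite /sqrt_sum scaler_sumr -big_split; apply: eq_bigr => k _.
by rewrite (linearP (iter k T)) /= scalerDr !scalerA mulrC.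
Qed.

HB.instance Definition _ n := GRing.isLinear.Build _ _ _ _ _ (sqrt_sum_is_linear n).

Lemma rnorm_sqrt_sum n x : rnorm (sqrt_sum n x) <= 2 * C * rnorm x.
Proof.
apply: le_trans (rnorm_sum _ _ _) _.
apply: (@le_trans _ _ (\sum_(0 <= k < n.+1) `|c k| * (C * rnorm x))).
  by apply: ler_sum => k _; rewrite rnormZ ler_wpM2l.
rewrite -mulr_suml -mulrA ler_wpM2r ?mulr_ge0 ?rnorm_ge0 //.
rewrite big_ltn // normr1 big_add1 /=.
under eq_bigr do rewrite distrC ger0_norm ?subr_ge0 ?isqrt_coef_le //.
have tele : \sum_(0 <= i < n) (p i.+1 - p i) = p n - 1 := telescope_sumr p (leq0n n).
have -> : \sum_(0 <= i < n) (p i - p i.+1) = 1 - p n.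
  by rewrite -opprB -tele -sumrN; apply: eq_bigr => i _; rewrite opprB.
by have := p0 n; lra.
Qed.

(** Summation by parts: the coefficients of [sqrt_sum] are differences of
    those of z.  This exhibits a factor I - T, on which M_n is small. *)
Lemma sqrt_sum_abel n x :
  let z := \sum_(0 <= j < n) emb (p j) *: iter j T x in
  sqrt_sum n x = z - T z + emb (p n) *: iter n T x.
Proof.
elim: n => [|n IH] /=.
  by rewrite /sqrt_sum big_nat1 big_geq // linear0 subrr add0r.
rewrite /sqrt_sum big_nat_recr //= -/(sqrt_sum n x) IH big_nat_recr //= linearD linearZ_LR.
rewrite rmorphB scalerBl.
have regroup (z tz a b d : X) : z - tz + a + (b - d) = z + a - (tz + d) + b.
  by rewrite opprD [in RHS]addrACA -!addrA; do 3 congr (_ + _); rewrite addrC.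
exact: regroup.
Qed.

(** In [sqrt_sum_abel], z has norm at most C times the sum of the p j for
    j < n, which is 2 n p n; the factor 1 / n gained on (I - T) z turns this
    into O(p n). *)
Lemma sqrt_sum_mean n x : rnorm (M n (sqrt_sum n x)) <= 5 * C ^+ 2 * p n * rnorm x.
Proof.
rewrite sqrt_sum_abel linearD (linearZ_LR (M n)).
set z := \sum_(_ <= _ < _) _.
have Nz : rnorm z <= 2 * n%:R * p n * (C * rnorm x).
  apply: le_trans (rnorm_sum _ _ _) _; rewrite -isqrt_coef_sum mulr_suml.
  by apply: ler_sum => j _; rewrite rnormZ ger0_norm // ler_wpM2l.
have -> : 5 * C ^+ 2 * p n * rnorm x = 4 * C ^+ 2 * p n * rnorm x + p n * (C * (C * rnorm x)).
  by ring.
apply: le_trans (rnormD _ _) _; apply: lerD; last first.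
  rewrite rnormZ ger0_norm // ler_wpM2l //.
  by apply: le_trans (rnorm_mean _ _) _; rewrite ler_wpM2l.
apply: le_trans (rnorm_mean_sub_T _ _) _.
have [->|n0] := eqVneq n 0%N.
  by rewrite invr0 mulr0 mul0r !mulr_ge0 ?rnorm_ge0 // exprn_ge0.
have n0' : n%:R != 0 :> R by rewrite pnatr_eq0.
have -> : 4 * C ^+ 2 * p n * rnorm x = 2 * C * n%:R^-1 * (2 * n%:R * p n * (C * rnorm x)).
  by field.
by rewrite ler_wpM2l // !mulr_ge0 // invr_ge0.
Qed.

(** By [sqrt_coef_conv] the diagonals i + j <= n of the product add up to
    I - T exactly; what remains has coefficients of total mass p n ^+ 2. *)
Lemma sqrt_sum_square n x : (0 < n)%N ->
  rnorm (sqrt_sum n (sqrt_sum n x) - (x - T x)) <= p n ^+ 2 * (C * rnorm x).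
Proof.
move=> n0.
pose F i j : X := emb (c i * c j) *: iter (i + j) T x.
have -> : sqrt_sum n (sqrt_sum n x) = \sum_(0 <= i < n.+1) \sum_(0 <= j < n.+1) F i j.
  apply: eq_bigr => i _; rewrite /sqrt_sum (linear_sum (iter i T)) scaler_sumr.
  apply: eq_bigr => j _.
  by rewrite (linearZ_LR (iter i T)) scalerA -rmorphM /= -iterD.
rewrite square_sum_split.
have -> : \sum_(0 <= m < n.+1) \sum_(0 <= i < m.+1) F i (m - i)%N = x - T x.
  have diag m : \sum_(0 <= i < m.+1) F i (m - i)%N =
      emb ((m == 0%N)%:R - (m == 1%N)%:R) *: iter m T x.
    rewrite -sqrt_coef_conv rmorph_sum scaler_suml.
    by apply: eq_big_nat => i /andP[_ im]; rewrite /F subnKC // -ltnS.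
  under eq_bigr do rewrite diag.
  rewrite big_ltn // big_ltn //= subr0 sub0r rmorph1 scale1r rmorphN rmorph1 scaleN1r.
  rewrite big_nat_cond big1 ?addr0 // => -[|[|m]] // _.
  by rewrite subrr rmorph0 scale0r.
rewrite addrAC subrr add0r -sqrt_coef_tail //.
apply: le_trans (rnorm_sum _ _ _) _; rewrite mulr_suml; apply: ler_sum => i _.
apply: le_trans (rnorm_sum _ _ _) _; rewrite mulr_suml; apply: ler_sum => j _.
by rewrite rnormZ normrM ler_wpM2l // mulr_ge0.
Qed.

(** A is the pointwise limit of [sqrt_sum], with error at most C p n N(x). *)
Lemma sqrt_I_minus_exists : exists A : X -> X,
  [/\ forall x y, A (x - y) = A x - A y,
      forall x, A (A x) = x - T x &
      forall n x, rnorm (M n (A x)) <= 6 * C ^+ 2 * p n * rnorm x].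
Proof.
have Aex x : exists l, sqrt_sum n x @[n --> \oo] --> l /\
    forall n, rnorm (l - sqrt_sum n x) <= p n * (C * rnorm x).
  have [n||l Al lA] := @cvgn_telescope _ _ _ (sqrt_sum ^~ x) (fun n => p n * (C * rnorm x)).
  - rewrite -mulrBl /sqrt_sum big_nat_recr //= addrAC subrr add0r rnormZ.
    rewrite ler0_norm ?subr_le0 ?isqrt_coef_le // opprB ler_wpM2l //.
      by rewrite subr_ge0 isqrt_coef_le.
    exact: (TC n.+1).
  - rewrite -(mul0r (C * rnorm x)); apply: cvgMr_tmp; exact: cvg_isqrt_coef.
  - by exists l.
have [A AP] := choice Aex.
have NA x n : rnorm (A x - sqrt_sum n x) <= p n * (C * rnorm x) by have [_] := AP x.
exists A; split=> [x y|x|n x].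
- have L : sqrt_sum n (x - y) @[n --> \oo] --> A x - A y.
    by under eq_cvg do rewrite linearB; apply: cvgB; [exact: (AP x).1|exact: (AP y).1].
  exact: (cvg_unique _ (AP _).1 L).
- pose D := C * rnorm (A x) + 2 * C * (C * rnorm x) + C * rnorm x.
  (* Compare A A x, sqrt_sum n (A x) and sqrt_sum n (sqrt_sum n x) in turn. *)
  have small n : (0 < n)%N -> rnorm (A (A x) - (x - T x)) <= p n * D.
    move=> n0.
    rewrite (_ : A (A x) - _ = (A (A x) - sqrt_sum n (A x)) +
      sqrt_sum n (A x - sqrt_sum n x) + (sqrt_sum n (sqrt_sum n x) - (x - T x))); last first.
      by rewrite (linearB (sqrt_sum n)) /= !addrA !subrK.
    rewrite /D !mulrDr; apply: le_trans (rnormD _ _) _; apply: lerD.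
      apply: le_trans (rnormD _ _) _; apply: lerD; first exact: NA.
      apply: le_trans (rnorm_sqrt_sum _ _) _; rewrite [leRHS]mulrCA ler_wpM2l //.
      exact: mulr_ge0.
    apply: le_trans (sqrt_sum_square _ n0) _; rewrite expr2 -mulrA ler_wpM2l //.
    rewrite ler_piMl ?mulr_ge0 ?rnorm_ge0 // -(expr_le1 (ltn0Sn 1)) //.
    have := isqrt_coef_sqr R n; have := sqr_ge0 (p n); have : (0 : R) <= n%:R by [].
    nra.
  apply/eqP; rewrite -subr_eq0; apply/eqP/rnorm_eq0/eqP.
  rewrite eq_le rnorm_ge0 andbT.
  have pD : p n * D @[n --> \oo] --> (0 : R).
    by rewrite -(mul0r D); apply: cvgMr_tmp; exact: cvg_isqrt_coef.
  rewrite -(cvg_lim _ pD) //; apply: limr_ge; first exact: cvgP pD.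
  by near=> n; apply: small; near: n; exact: nbhs_infty_gt.
- rewrite -(subrK (sqrt_sum n x) (A x)) linearD.
  have -> : 6 * C ^+ 2 * p n * rnorm x = C * (p n * (C * rnorm x)) + 5 * C ^+ 2 * p n * rnorm x.
    by ring.
  apply: le_trans (rnormD _ _) _; apply: lerD; last exact: sqrt_sum_mean.
  by apply: le_trans (rnorm_mean _ _) _; rewrite ler_wpM2l.
Unshelve. all: by end_near. Qed.

(** * The domain of the one-sided Hilbert transform *)

(** By Abel summation the increments of hilbert_sum n x - M n x are
    M n x / (n + 1).  With the rate p n they are summable, since
    p n / (n + 1) = 2 (p n - p n.+1) telescopes. *)
Lemma mean_rate_hilbert_domain (D : R) x :
  (forall n, rnorm (M n x) <= D * p n) -> hilbert_domain T x.
Proof.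
move=> MD.
have meanS n : n.+1%:R *: M n.+1 x = n%:R *: M n x + iter n.+1 T x.
  rewrite /ergodic_mean !scalerA divff ?pnatr_eq0 // scale1r big_nat_recr //=.
  case: n => [|n]; first by rewrite mul0r scale0r big_geq.
  by rewrite divff ?pnatr_eq0 // scale1r.
have [n||l ul _] := @cvgn_telescope _ _ _ (fun n => hilbert_sum n x - M n x)
    (fun n => 2 * D * p n).
- have -> : hilbert_sum n.+1 x - M n.+1 x - (hilbert_sum n x - M n x) =
      n.+1%:R^-1 *: M n x.
    have n0 : n.+1%:R != 0 :> K by rewrite pnatr_eq0.
    have step (a t m' m : X) : a + t - m' - (a - m) = t - m' + m.
      by rewrite opprB -(addrA a) [a + _]addrC addrACA subrr addr0.
    rewrite /hilbert_sum big_nat_recr //= step.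
    apply: (scalerI n0); rewrite scalerDr scalerBr meanS !(scalerKV n0).
    rewrite opprD [- _ - _]addrC addrA subrr add0r -(natr1 n) scalerDl scale1r.
    by rewrite addrA addNr add0r.
  rewrite rnormZ_nat -mulrBr isqrt_coefB.
  have -> : 2 * D * (p n / (2 * n%:R + 2)) = n.+1%:R^-1 * (D * p n).
    have n1 : n%:R + 1 != 0 :> R by rewrite natr1 pnatr_eq0.
    have -> : 2 * n%:R + 2 = 2 * (n%:R + 1) :> R by ring.
    by rewrite -(natr1 n); field.
  by rewrite ler_wpM2l // invr_ge0.
- rewrite -(mulr0 (2 * D)); apply: cvgMl_tmp; exact: cvg_isqrt_coef.
have M0 : M n x @[n --> \oo] --> (0 : X).
  apply/cvgn_rnormP; apply: (near_le_cvg0 (g := fun n => D * p n)).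
  - by move=> n; exact: rnorm_ge0.
  - by near=> n; rewrite subr0.
  - rewrite -(mulr0 D); apply: cvgMl_tmp; exact: cvg_isqrt_coef.
apply: (cvgP (l + 0)).
rewrite (_ : (fun n => _) = (fun n => hilbert_sum n x - M n x) \+ (M ^~ x)).
  exact: cvgD.
by apply/funext => n /=; rewrite subrK.
Unshelve. all: by end_near. Qed.

Lemma hilbert_domain_mean_bounded x : hilbert_domain T x ->
  exists B, forall n, harmonic_sum R n * rnorm (M n x) <= B.
Proof.
move=> /cvg_ex[l /cvgn_rnormP/cvgr0Pnorm_lt/(_ 1 ltr01)[m _ Hl]].
pose b := 1 + rnorm l.
have bm n : (m <= n)%N -> rnorm (hilbert_sum n x) <= b.
  move=> mn; rewrite -(subrK l (hilbert_sum n x)).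
  apply: le_trans (rnormD _ _) _; rewrite lerD2r.
  by have := Hl n mn; rewrite ger0_norm ?rnorm_ge0 // => /ltW.
pose S := \sum_(i < m) rnorm (hilbert_sum i x).
have S0 : 0 <= S by apply: sumr_ge0 => i _; exact: rnorm_ge0.
have b0 : 0 <= b by rewrite addr_ge0 ?rnorm_ge0.
exists (C * (S + b) + 2 * C ^+ 2 * rnorm x) => n.
apply: le_trans (harmonic_mean_le n x) _; rewrite lerD2r ler_wpM2l //.
have [mn|nm] := leqP m n; first by rewrite (le_trans (bm n mn)) // lerDr.
rewrite ler_wpDr // /S (bigD1 (Ordinal nm)) //= lerDl.
by apply: sumr_ge0 => i _; exact: rnorm_ge0.
Qed.

(** As the harmonic sums diverge, boundedness of harmonic_sum n times
    N(M n x) forces M n x to tend to 0. *)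
Lemma hilbert_domain_sub_closure : hilbert_domain T `<=` Y.
Proof.
move=> x /hilbert_domain_mean_bounded[B hB].
apply/closure_range_cvg/cvgn_rnormP/cvgr0Pnorm_lt => e e0.
near=> n; rewrite subr0 ger0_norm ?rnorm_ge0 //.
have hn : (`|B| + 1) / e <= harmonic_sum R n.
  by near: n; move/cvgryPge : (@harmonic_sum_dvg R); exact.
rewrite ltNge; apply/negP => eM.
have h0 : 0 <= harmonic_sum R n by apply: sumr_ge0 => k _; rewrite invr_ge0.
have := le_trans (ler_wpM2l h0 eM) (hB n).
move: hn; rewrite ler_pdivrMr // => hn h; have := le_trans hn h.
by have := ler_norm B; lra.
Unshelve. all: by end_near. Qed.

(** x - T x = A (A x) lies in the range of A, where the means decay fast enough
    for the Hilbert series to converge. *)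
Lemma range_sub_hilbert_domain : range_I_minus T `<=` hilbert_domain T.
Proof.
have [A [_ AA MA]] := sqrt_I_minus_exists.
move=> _ [x _ <-]; rewrite -AA.
apply: (mean_rate_hilbert_domain (D := 6 * C ^+ 2 * rnorm (A x))) => n.
by rewrite mulrAC.
Qed.

(** A y has the decay that puts it in the Hilbert domain, hence in the range of
    I - T = A A: A y = A (A w).  The difference y - A w is killed by A, so it is
    fixed by T, and it lies in Y, on which M n tends to 0: it vanishes. *)
Lemma hilbert_domain_range_rate : hilbert_domain T = range_I_minus T ->
  forall y, Y y -> exists B, forall n, rnorm (M n y) <= B * p n.
Proof.
move=> DR y Yy; have [A [AB AA MA]] := sqrt_I_minus_exists.
have MA' n x : rnorm (M n (A x)) <= 6 * C ^+ 2 * rnorm x * p n by rewrite mulrAC.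
have : hilbert_domain T (A y) by exact: (mean_rate_hilbert_domain (fun n => MA' n y)).
rewrite DR => -[w _ wy].
pose f := y - A w.
have Tf : T f = f.
  have A0 : A 0 = 0 by have := AB 0 0; rewrite !subrr.
  have : A (A f) = 0 by rewrite AB AA wy subrr.
  by rewrite AA => /eqP; rewrite subr_eq0 => /eqP.
have YAw : Y (A w).
  by apply: hilbert_domain_sub_closure; exact: (mean_rate_hilbert_domain (fun n => MA' n w)).
have f0 : f = 0.
  have : Y f by apply: closure_rangeD => //; rewrite -scaleN1r; exact: closure_rangeZ.
  move=> /closure_range_cvg Mf.
  have Mf' : M n f @[n --> \oo] --> f.
    apply: cvg_near_cst; near=> n; apply: mean_fixed => //.
    by near: n; exact: nbhs_infty_gt.
  exact: (cvg_unique _ Mf' Mf).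
exists (6 * C ^+ 2 * rnorm w) => n.
by rewrite -(subrK (A w) y) -/f f0 add0r.
Unshelve. all: by end_near. Qed.

End PowerBounded.

Theorem theorem2p11 (R : realType) (s : scalars)
    (X : completeNormedModType (scalar_field R s)) (T : {linear X -> X})
    (T_bounded : bounded_operator T) (T_power_bounded : power_bounded T) :
  [<-> uniformly_ergodic T;
       closed (hilbert_domain T);
       hilbert_domain T = closure (range_I_minus T);
       hilbert_domain T = range_I_minus T;
       forall y : X, closure (range_I_minus T) y ->
         exists2 beta : R, 0 < beta < 1 &
           (fun n : nat => rnorm (ergodic_mean T n y)) =O_\oo
             (fun n : nat => 1 / n%:R `^ beta)].
Proof.
have [C C1 TC] := power_boundedP T_power_bounded.
have RD := range_sub_hilbert_domain C1 TC.
have DY := hilbert_domain_sub_closure C1 TC.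
tfae.
- move=> /(uniformly_ergodic_contraction C1 TC) /(contraction_closed_range C1 TC) YR.
  rewrite (_ : hilbert_domain T = closure (range_I_minus T)); first exact: closed_closure.
  by apply/seteqP; split=> // x; rewrite YR; exact: RD.
- move=> /closure_id Dclosed; apply/seteqP; split=> // x Yx.
  by rewrite Dclosed; exact: closure_subset Yx.
- move=> DE; have Q : mean_contraction T.
    apply: (divergent_rate_contraction C1 TC (@harmonic_sum_dvg R)) => y.
    rewrite -DE => /(hilbert_domain_mean_bounded C1 TC)[B hB].
    by exists B; near=> n.
  by rewrite DE; exact: (contraction_closed_range C1 TC).
- move=> DR y /(hilbert_domain_range_rate C1 TC DR)[B hB].
  exists 2^-1; first by apply/andP; split; lra.
  apply/eqO_exP; exists (`|B| + 1); first by rewrite ltr_wpDl.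
  near=> n.
  rewrite (ger0_norm (rnorm_ge0 _)) [`|1 / _|]ger0_norm ?divr_ge0 ?powR_ge0 //.
  have n0 : (0 < n)%N by near: n; exact: nbhs_infty_gt.
  apply: le_trans (hB n) _; apply: (@le_trans _ _ ((`|B| + 1) * isqrt_coef R n)).
    by rewrite ler_wpM2r ?(ltW (isqrt_coef_gt0 _ _)) // (le_trans (ler_norm B)) // lerDl.
  by rewrite ler_wpM2l ?isqrt_coef_powR // addr_ge0.
- move=> rate; apply: (contraction_uniformly_ergodic C1 TC).
  apply: (divergent_rate_contraction C1 TC (@harmonic_sum_dvg R)) => y /rate.
  move=> [b /andP[b0 _] /eqO_exP[k k0 My]].
  exists (k * (1 + b^-1)); near=> n.
  have n0 : (0 < n)%N by near: n; exact: nbhs_infty_gt.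
  have nb : 0 < (n%:R : R) `^ b by rewrite powR_gt0 ?ltr0n.
  have Mn : rnorm (ergodic_mean T n y) <= k * (1 / n%:R `^ b).
    rewrite -(ger0_norm (rnorm_ge0 (ergodic_mean T n y))).
    rewrite -[1 / _]ger0_norm ?divr_ge0 ?(ltW nb) //; near: n; exact: My.
  apply: le_trans (ler_pM _ _ (harmonic_sum_powR b0 n0) Mn) _.
  - by apply: sumr_ge0 => i _; rewrite invr_ge0.
  - exact: rnorm_ge0.
  - rewrite le_eqVlt; apply/orP; left; apply/eqP; field.
    by rewrite !gt_eqF.
Unshelve. all: by end_near.
Qed.
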